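(* Every random real $z$ computes an $n/(\log n)^2$-fat set of incompressible strings. That is, for every Martin-Löf random $z\in 2^\omega$ there is a set $D\subseteq 2^{<\omega}$ with $D\leq_T z$ and $\sup_{\sigma\in D}(|\sigma|-K(\sigma))<\infty$ such that $\max_{i\leq n}|D\cap 2^i|\geq n/(\log n)^2$ for all $n\geq 2$.
   Context: $2^\omega$ is the set of infinite binary sequences (reals), $2^{<\omega}$ the set of finite binary strings, $2^i$ the set of $i$-bit strings. $K$ is prefix-free Kolmogorov complexity with respect to a fixed universal prefix-free machine. ''Random'' means Martin-Löf random. $\leq_T$ is Turing reducibility. The deficiency of a string $\sigma$ is $|\sigma|-K(\sigma)$; the deficiency of a set of strings is the supremum of the deficiencies of its members; a set of strings is a set of incompressible strings if its deficiency is finite. A set $D\subseteq 2^{<\omega}$ is $g$-fat if $\max_{i\leq n}|D\cap 2^i|\geq g(n)$ for all $n$. $\log$ is the base-2 logarithm. *)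

(* Defs.v *)
From mathcomp Require Import all_boot all_order all_algebra.
From mathcomp Require Import all_classical all_reals all_analysis.
Set Implicit Arguments.
Unset Strict Implicit.
Unset Printing Implicit Defensive.
Import Order.TTheory GRing.Theory Num.Theory.

Local Open Scope classical_set_scope.
Local Open Scope nat_scope.

(* Partial functions are represented by their graphs. *)
Definition pfun (n : nat) := n.-tuple nat -> nat -> Prop.

(* Kleene's mu-recursive function symbols of arity n, with one extra basic
   function ROracle standing for the oracle. *)
Inductive recf : nat -> Type :=
| RZero n : recf n
| RSucc : recf 1
| RProj n (i : 'I_n) : recf n
| ROracle : recf 1
| RComp k n (f : recf k) (g : 'I_k -> recf n) : recf n
| RPrec n (f : recf n) (g : recf n.+2) : recf n.+1
| RMin n (f : recf n.+1) : recf n.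

Fixpoint prim_rec n (f : pfun n) (g : pfun n.+2) (k : nat) : pfun n :=
  fun v y => match k with
  | 0 => f v y
  | k'.+1 => exists2 u, prim_rec f g k' v u & g [tuple of k' :: u :: v] y
  end.

(* The values at all i < y have to be defined (and positive). *)
Definition minimization n (f : pfun n.+1) : pfun n :=
  fun v y => f [tuple of y :: v] 0 /\
    forall i, i < y -> exists u, f [tuple of i :: v] u.+1.

(* [rec_eval z f v y]: the function denoted by f relative to the oracle z is
   defined at v, with value y. *)
Fixpoint rec_eval (z : nat -> bool) n (f : recf n) : pfun n :=
  match f in recf n return pfun n with
  | RZero _ => fun _ y => y = 0
  | RSucc => fun v y => y = (thead v).+1
  | RProj _ i => fun v y => y = tnth v i
  | ROracle => fun v y => y = z (thead v)
  | RComp k _ f g => fun v y =>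
      exists2 w : k.-tuple nat,
        (forall i, rec_eval z (g i) v (tnth w i)) & rec_eval z f w y
  | RPrec _ f g => fun v y =>
      prim_rec (rec_eval z f) (rec_eval z g) (thead v) [tuple of behead v] y
  | RMin _ f => minimization (rec_eval z f)
  end.

(* Unrelativized computability is computability from the empty oracle. *)
Definition no_oracle : nat -> bool := fun=> false.

(* Bijective base-2 numeration, a computable bijection from finite binary
   strings to natural numbers. *)
Definition str_code (s : seq bool) : nat :=
  foldr (fun (b : bool) n => n.*2 + b.+1) 0 s.

Definition turing_le (D : set (seq bool)) (z : nat -> bool) : Prop :=
  exists f : recf 1,
    forall s, rec_eval z f [tuple str_code s] (nat_of_bool (s \in D)).

Definition partial_computable (M : seq bool -> seq bool -> Prop) : Prop :=
  exists f : recf 1,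
    forall p s, M p s <-> rec_eval no_oracle f [tuple str_code p] (str_code s).

Definition prefix_free_machine (M : seq bool -> seq bool -> Prop) : Prop :=
  partial_computable M /\
  forall p q s t, M p s -> M q t -> prefix p q -> p = q.

Definition universal_prefix_free_machine
    (U : seq bool -> seq bool -> Prop) : Prop :=
  prefix_free_machine U /\
  forall M, prefix_free_machine M ->
    exists rho, forall p s, U (rho ++ p) s <-> M p s.

Definition uniformly_ce (W : nat -> set (seq bool)) : Prop :=
  exists f : recf 2, forall n s,
    W n s <-> exists y, rec_eval no_oracle f [tuple n; str_code s] y.

Definition level_max (D : set (seq bool)) (n : nat) : nat :=
  \max_(i < n.+1) #|[pred t : i.-tuple bool | tval t \in D]|.

Definition cylinders (S : set (seq bool)) : set (nat -> bool) :=
  [set x | exists2 s, S s & mkseq x (size s) = s].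

Local Open Scope ring_scope.
Local Open Scope ereal_scope.

Section RealValued.
Variable R : realType.

(* K is +oo on strings without a description; a universal machine has
   none. *)
Definition K (U : seq bool -> seq bool -> Prop) (s : seq bool) : \bar R :=
  ereal_inf [set (size p)%:R%:E | p in [set p | U p s]].

Definition deficiency (U : seq bool -> seq bool -> Prop) (s : seq bool) :
  \bar R := (size s)%:R%:E - K U s.

Definition set_deficiency (U : seq bool -> seq bool -> Prop)
    (D : set (seq bool)) : \bar R :=
  ereal_sup [set deficiency U s | s in D].

Definition incompressible_strings (U : seq bool -> seq bool -> Prop)
    (D : set (seq bool)) : Prop := set_deficiency U D < +oo.

(* The outer measure of the uniform (fair coin) measure on binary sequences,
   as in Caratheodory's construction; it agrees with the measure on open
   sets. *)
Definition uniform_outer_measure (A : set (nat -> bool)) : \bar R :=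
  ereal_inf [set \esum_(s in S) ((2%:R ^- size s)%:E : \bar R) |
              S in [set S : set (seq bool) | A `<=` cylinders S]].

Definition martin_lof_test (W : nat -> set (seq bool)) : Prop :=
  uniformly_ce W /\
  forall n, uniform_outer_measure (cylinders (W n)) <= (2%:R ^- n)%:E.

Definition martin_lof_random (z : nat -> bool) : Prop :=
  forall W, martin_lof_test W -> ~ (\bigcap_n cylinders (W n)) z.

Definition log2 (x : R) : R := (ln x / ln 2)%R.

End RealValued.

(* Main.v *)
(* For a string s of length i, let T(s) be s with its first k ~ log i bits
   overwritten by the k-bit string that codes i.  The set D of strings s such
   that T(s) is a prefix of z is computable from z and has 2^k elements of length
   code(z|k) < 2^(k+1) for each k.  Conversely, the prefixes T(s) for s with a
   U-description p of length at most |s| - n have total weight at most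
   sum 2^(-|T(s)|) <= 2^(-n) sum 2^(-|p|) <= 2^(-n), since T preserves lengths, so
   they form a Martin-Loef test; the level n at which z passes it bounds the
   deficiency of D. *)

Require Import Defs.
From mathcomp Require Import all_boot all_order all_algebra.
From mathcomp Require Import finmap all_classical all_reals all_analysis.
From mathcomp Require Import lra.
Import Order.TTheory GRing.Theory Num.Theory.
Set Implicit Arguments.
Unset Strict Implicit.
Unset Printing Implicit Defensive.
Local Open Scope nat_scope.

(** * Recursive functions *)

Lemma rec_eval_fun z n (f : recf n) v y y' :
  rec_eval z f v y -> rec_eval z f v y' -> y = y'.
Proof.
elim: f v y y' => {n} [n||n i||k n f IHf g IHg|n f IHf g IHg|n f IHf] v y y' /=;
  try by move=> -> ->.
- move=> [w gw fw] [w' gw' fw'].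
  have eww' : w = w' by apply: eq_from_tnth => i; exact: IHg (gw i) (gw' i).
  by rewrite -eww' in fw'; exact: IHf fw fw'.
- elim: (thead v) y y' => [|m IHm] y y' /=; first exact: IHf.
  by move=> [u fu gu] [u' fu' gu']; rewrite (IHm _ _ fu fu') in gu; exact: IHg gu gu'.
- move=> [fy ly] [fy' ly']; case: (ltngtP y y') => // lt.
  + by have [u fu] := ly' _ lt; have := IHf _ _ _ fy fu.
  + by have [u fu] := ly _ lt; have := IHf _ _ _ fy' fu.
Qed.

(** The specification [F] acts on plain lists, so arguments can be handled by [nth] and [behead]
    without dependent types. Only its values on lists of length [n] matter. *)
Definition total_recursive (z : nat -> bool) n (F : seq nat -> nat) : Prop :=
  exists f : recf n, forall (v : n.-tuple nat) y, rec_eval z f v y <-> y = F v.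

Section TotalRecursive.
Variable z : nat -> bool.
Local Notation TR := (total_recursive z).

Lemma rec_ext n F G :
  (forall v, size v = n -> F v = G v) -> TR n F -> TR n G.
Proof.
by move=> FG [f fF]; exists f => v y; rewrite fF FG ?size_tuple.
Qed.

Lemma rec_zero n : TR n (fun=> 0).
Proof. by exists (RZero n). Qed.

Lemma rec_nth n j : TR n (nth 0 ^~ j).
Proof.
have [jn|nj] := ltnP j n.
  by exists (RProj (Ordinal jn)) => v y /=; rewrite (tnth_nth 0).
by apply: rec_ext (rec_zero n) => v sv; rewrite nth_default // sv.
Qed.

Lemma rec_comp n F (G : seq (seq nat -> nat)) :
  TR (size G) F -> (forall i : 'I_(size G), TR n (nth (fun=> 0) G i)) ->
  TR n (fun v => F [seq g v | g <- G]).
Proof.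
move=> [f fF] /fin_all_exists[g gG].
have sG (v : seq nat) : size [seq h v | h <- G] == size G by rewrite size_map.
exists (RComp f g) => v y /=; split=> [[w gw fw]|->].
  have -> : [seq h (tval v) | h <- G] = w.
    apply: (@eq_from_nth _ 0) => [|i]; first by rewrite size_map size_tuple.
    rewrite size_map => iG; rewrite (nth_map (fun=> 0)) //.
    by have /gG := gw (Ordinal iG); rewrite (tnth_nth 0).
  exact/fF.
exists (Tuple (sG v)); last exact/fF.
by move=> i; apply/gG; rewrite (tnth_nth 0) /= (nth_map (fun=> 0)).
Qed.

Lemma rec_app1 n F G : TR 1 F -> TR n G -> TR n (fun v => F [:: G v]).
Proof.
by move=> hF hG; apply: (@rec_comp n F [:: G]) => // -[[|]].
Qed.

Lemma rec_app2 n F G1 G2 :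
  TR 2 F -> TR n G1 -> TR n G2 -> TR n (fun v => F [:: G1 v; G2 v]).
Proof.
by move=> hF h1 h2; apply: (@rec_comp n F [:: G1; G2]) => // -[[|[|]]].
Qed.

Lemma rec_prec n A B (H : nat -> seq nat -> nat) :
    TR n A -> TR n.+2 B -> (forall v, size v = n -> H 0 v = A v) ->
    (forall k v, size v = n -> H k.+1 v = B [:: k, H k v & v]) ->
  TR n.+1 (fun v => H (nth 0 v 0) (behead v)).
Proof.
move=> [f fA] [g gB] H0 HS; exists (RPrec f g) => v y /=.
have -> : nth 0 v 0 = thead v by rewrite /thead (tnth_nth 0).
have sv : size (behead v) = n by rewrite size_behead size_tuple.
elim: (thead v) y => [|k IHk] y /=; first by rewrite fA H0.
rewrite HS //; split=> [[u /IHk -> /gB ->] //|->].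
by exists (H k (behead v)); [exact/IHk | exact/gB].
Qed.

(** The zeros of [F] are exactly the [y] from [L v] on, so [L v] is the least zero and all earlier
    values are positive, as [minimization] requires. *)
Lemma rec_min n F L : TR n.+1 F ->
    (forall y v, size v = n -> (F (y :: v) == 0) = (L v <= y)) ->
  TR n L.
Proof.
move=> [f fF] FL; exists (RMin f) => v y /=.
have sv : size v = n by rewrite size_tuple.
rewrite /minimization; split=> [[/fF fy ly]|->].
  apply/eqP; rewrite eqn_leq leqNgt -FL // -fy eqxx andbT; apply/negP => Ly.
  have [u /fF /= uF] := ly _ Ly.
  by have := FL (L v) v sv; rewrite -uF leqnn.
split; first by apply/fF/esym/eqP; rewrite /= FL.
move=> i iL; exists (F (i :: v)).-1; apply/fF; rewrite /= prednK //.
by rewrite lt0n FL // -ltnNge.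
Qed.

Lemma rec_succ n F : TR n F -> TR n (fun v => (F v).+1).
Proof.
apply: (@rec_app1 n (fun v => (nth 0 v 0).+1)); exists RSucc => v y /=.
by rewrite /thead (tnth_nth 0).
Qed.

Lemma rec_cst n m : TR n (fun=> m).
Proof. by elim: m => [|m IHm]; [exact: rec_zero|exact: rec_succ]. Qed.

Lemma rec_oracle n F : TR n F -> TR n (fun v => nat_of_bool (z (F v))).
Proof.
apply: (@rec_app1 n (fun v => nat_of_bool (z (nth 0 v 0)))); exists ROracle => v y /=.
by rewrite /thead (tnth_nth 0).
Qed.

Lemma rec_pred n F : TR n F -> TR n (fun v => (F v).-1).
Proof.
apply: (@rec_app1 n (fun v => (nth 0 v 0).-1)).
by apply: (@rec_prec 0 _ _ (fun k _ => k.-1) (rec_zero _) (rec_nth _ 0)).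
Qed.

Lemma rec_add n F G : TR n F -> TR n G -> TR n (fun v => F v + G v).
Proof.
apply: (@rec_app2 n (fun v => nth 0 v 0 + nth 0 v 1)).
apply: rec_ext (@rec_prec 1 _ _ (fun k v => k + nth 0 v 0) (rec_nth _ 0)
  (rec_succ (rec_nth _ 1)) _ _) => // -[|a [|b []]] //.
Qed.

Lemma rec_sub n F G : TR n F -> TR n G -> TR n (fun v => F v - G v).
Proof.
(* The arguments are swapped because [RPrec] recurses on the first one, here the number
   subtracted. *)
move=> hF hG; apply: (@rec_app2 n (fun v => nth 0 v 1 - nth 0 v 0)) => //.
apply: rec_ext (@rec_prec 1 _ _ (fun k v => nth 0 v 0 - k) (rec_nth _ 0)
  (rec_pred (rec_nth _ 1)) _ _) => [[|a [|b []]] //|v _|k v _ /=].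
  by rewrite subn0.
by rewrite subnS.
Qed.

Lemma rec_mul n F G : TR n F -> TR n G -> TR n (fun v => F v * G v).
Proof.
apply: (@rec_app2 n (fun v => nth 0 v 0 * nth 0 v 1)).
apply: rec_ext (@rec_prec 1 _ _ (fun k v => k * nth 0 v 0) (rec_zero _)
  (rec_add (rec_nth _ 2) (rec_nth _ 1)) _ _) => // -[|a [|b []]] //.
Qed.

Lemma rec_exp2 n F : TR n F -> TR n (fun v => 2 ^ F v).
Proof.
apply: (@rec_app1 n (fun v => 2 ^ nth 0 v 0)).
apply: (@rec_prec 0 _ _ (fun k _ => 2 ^ k) (rec_cst _ 1)
  (rec_add (rec_nth _ 1) (rec_nth _ 1))) => // k v _ /=.
by rewrite expnS mul2n addnn.
Qed.

Lemma rec_half n F : TR n F -> TR n (fun v => (F v)./2).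
Proof.
apply: (@rec_app1 n (fun v => (nth 0 v 0)./2)).
(* The recurrence [k.+1./2 = k - k./2] avoids any test of parity. *)
apply: (@rec_prec 0 _ _ (fun k _ => k./2) (rec_zero _)
  (rec_sub (rec_nth _ 0) (rec_nth _ 1))) => // k v _ /=.
by rewrite uphalf_half -[X in X - _](odd_double_half k) -addnn addnA addnK.
Qed.

Lemma rec_dist n F G : TR n F -> TR n G ->
  TR n (fun v => (F v - G v) + (G v - F v)).
Proof. by move=> hF hG; apply: rec_add; apply: rec_sub. Qed.

(** On codes of strings, [m.-1./2] deletes the first bit, so the iteration computes [drop]; see
    [str_code_tail]. *)
Lemma rec_iter_code_tail n F G : TR n F -> TR n G ->
  TR n (fun v => iter (F v) (fun m => m.-1./2) (G v)).
Proof.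
apply: (@rec_app2 n (fun v => iter (nth 0 v 0) (fun m => m.-1./2) (nth 0 v 1))).
apply: rec_ext (@rec_prec 1 _ _ (fun k v => iter k (fun m => m.-1./2) (nth 0 v 0))
  (rec_nth _ 0) (rec_half (rec_pred (rec_nth _ 1))) _ _) => // -[|a [|b []]] //.
Qed.

(** A source of c.e. sets: run the partial function [g] once, then apply the total test [F] to its
    output, diverging when the test fails. *)
Lemma rec_domain n F P (g : recf 1) :
    TR n.+1 F -> TR n P ->
  exists f : recf n, forall v, (exists y, rec_eval z f v y) <->
    exists2 d, rec_eval z g [tuple P v] d & F (d :: v) = 0.
Proof.
move=> [fF hF] [fP hP].
pose args (i : 'I_n.+1) : recf n :=
  if unlift ord0 i is Some j then RProj j else RComp g (fun=> fP).
(* The minimized function ignores the search variable and returns the value of [F]: the search stops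
   at 0 if that value is 0 and is undefined otherwise. *)
exists (RComp (RMin (RProj (@Ordinal 2 1 isT))) (fun=> RComp fF args)) => v.
split=> [[y /= [w /(_ ord0)[u uargs /hF uF] [w0 _]]]|[d gd Fd]].
  have := uargs ord0; rewrite /args unlift_none /= => -[a /(_ ord0)/hP aP ga].
  exists (thead u).
    rewrite /thead; congr (rec_eval z g _ _) : ga.
    by apply: eq_from_tnth => i; rewrite ord1 aP.
  have <- : tval u = thead u :: v.
    rewrite (tuple_eta u); congr cons; apply: (@eq_from_nth _ 0).
      by rewrite size_behead !size_tuple.
    rewrite size_behead size_tuple => i ilt /=.
    have := uargs (lift ord0 (Ordinal ilt)); rewrite /args liftK /=.
    by rewrite !(tnth_nth 0) /= nth_behead => <-.
  by move: uF w0; rewrite !(tnth_nth 0) /= => <- <-.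
exists 0 => /=; exists [tuple 0]; last by split=> // ; rewrite (tnth_nth 0).
move=> i; rewrite ord1; exists [tuple of d :: v]; last exact/hF.
move=> j; rewrite /args; case: unliftP => [k ->|->] /=.
  by rewrite !(tnth_nth 0).
exists [tuple P v] => // k; rewrite ord1; exact/hP.
Qed.

End TotalRecursive.

(** * Coding of strings *)

Lemma str_code_cat s t : str_code (s ++ t) = str_code s + 2 ^ size s * str_code t.
Proof.
elim: s => [|b s IHs]; first by rewrite /= expn0 mul1n.
rewrite /= -/(str_code (s ++ t)) -/(str_code s) IHs -!mul2n mulnDr addnAC.
by rewrite expnS mulnA.
Qed.

(** The inverse of [str_code]; [n] is fuel, and [m] itself suffices since [m'./2] is below
    [m'.+1]. *)
Fixpoint str_of_rec n m : seq bool :=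
  if n is n'.+1 then
    if m is m'.+1 then odd m' :: str_of_rec n' m'./2 else [::]
  else [::].

Definition str_of m := str_of_rec m m.

Lemma str_ofK : cancel str_of str_code.
Proof.
suff: forall n m, m <= n -> str_code (str_of_rec n m) = m by move=> + m; apply.
elim=> [|n IHn] [|m] //= mn.
have mn2 : m./2 <= n.
  by apply: (@leq_trans m) => //; rewrite -{2}(odd_double_half m) -addnn addnA leq_addl.
by rewrite -/(str_code _) IHn // addnS addnC odd_double_half.
Qed.

Lemma str_code_inj : injective str_code.
Proof.
elim=> [|b s IHs] [|c t] //=; rewrite -?/(str_code _) ?addnS // => -[].
rewrite -/(str_code _) !(addnC _.*2) => bc; have := congr1 odd bc.
rewrite !oddD !odd_double !addbF !oddb => ebc; rewrite ebc in bc *.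
by congr (_ :: _); apply: IHs; apply: double_inj; move/addnI: bc.
Qed.

Lemma str_codeK : cancel str_code str_of.
Proof. by move=> s; apply: str_code_inj; rewrite str_ofK. Qed.

Lemma size_le_str_code s : size s <= str_code s.
Proof.
elim: s => //= b s; rewrite -/(str_code s) addnS ltnS => /leq_trans; apply.
by rewrite -addnn -addnA leq_addr.
Qed.

Lemma str_code_lt s : str_code s < 2 ^ (size s).+1 - 1.
Proof.
rewrite ltn_subRL addnC addn1; elim: s => [|b s IHs] //=; rewrite -/(str_code s).
rewrite expnS mul2n; apply: leq_trans (_ : (str_code s).+2.*2 <= _).
  by rewrite !doubleS addnS; case: b; rewrite ?addn0 ?addn1.
by rewrite leq_double.
Qed.

Lemma str_code_ge s : 2 ^ size s <= (str_code s).+1.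
Proof.
elim: s => [|b s IHs] //=; rewrite -/(str_code s) expnS mul2n.
apply: leq_trans (_ : (str_code s).+1.*2 <= _); first by rewrite leq_double.
by rewrite doubleS addnS !ltnS leq_addr.
Qed.

Lemma str_code_tail s k :
  iter k (fun m => m.-1./2) (str_code s) = str_code (drop k s).
Proof.
elim: k s => [|k IHk] [|b s] //; rewrite iterSr /=; first exact: (IHk [::]).
rewrite -/(str_code s) addnS /= -IHk; congr iter.
by rewrite halfD odd_double /= doubleK; case: b; rewrite ?addn0.
Qed.

(** The string coded by [m] is the binary expansion of [m.+1], lowest bit first, without its leading
    1. *)
Lemma size_str_of k m : 2 ^ k <= m.+1 < 2 ^ k.+1 -> size (str_of m) = k.
Proof.
move=> /(trunc_log_eq (isT : 1 < 2)) <-; apply/esym/trunc_log_eq => //.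
rewrite -{2 3}(str_ofK m) str_code_ge /=.
by have := str_code_lt (str_of m); rewrite ltn_subRL add1n.
Qed.

(* Overwrites the first [log2 (size s)] or so bits of [s] with the string whose
   code is [size s]; the size is unchanged. *)
Definition tagged s :=
  let t := str_of (size s) in t ++ drop (size t) s.

Lemma size_str_of_le m : size (str_of m) <= m.
Proof. by rewrite -{2}(str_ofK m) size_le_str_code. Qed.

Lemma size_tagged s : size (tagged s) = size s.
Proof. by rewrite size_cat size_drop subnKC // size_str_of_le. Qed.

Section TaggedRecursive.
Variable z : nat -> bool.
Local Notation TR := (total_recursive z).

(** The length is the least number of bits to delete before the code becomes 0, the code of the
    empty string. *)
Lemma rec_code_size n F : TR n F -> TR n (fun v => size (str_of (F v))).
Proof.
apply: (@rec_app1 z n (fun v => size (str_of (nth 0 v 0)))).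
apply: rec_min (rec_iter_code_tail (rec_nth _ _ 0) (rec_nth _ _ 1)) _ => y v _ /=.
rewrite -{1}(str_ofK (nth 0 v 0)) str_code_tail -(subn_eq0 _ y) -size_drop size_eq0.
by apply/eqP/eqP => [/(@str_code_inj _ [::])|->].
Qed.

Lemma rec_tagged n F : TR n F -> TR n (fun v => str_code (tagged (str_of (F v)))).
Proof.
move=> hF.
(* [hS] computes the size of the string, which is also the code of the overwriting block; [hT]
   computes the length of that block. *)
have hS := rec_code_size hF; have hT := rec_code_size hS.
apply: rec_ext (rec_add hS (rec_mul (rec_exp2 hT) (rec_iter_code_tail hT hF))).
move=> v _; rewrite /tagged str_code_cat str_ofK.
by rewrite -[X in iter _ _ X]str_ofK str_code_tail.
Qed.

Lemma rec_prefix_oracle n F : TR n F -> TR n (fun v => str_code (mkseq z (F v))).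
Proof.
apply: (@rec_app1 z n (fun v => str_code (mkseq z (nth 0 v 0)))).
apply: (@rec_prec z 0 _ _ (fun k _ => str_code (mkseq z k)) (rec_zero _ _)
  (rec_add (rec_nth _ _ 1) (rec_mul (rec_exp2 (rec_nth _ _ 0))
     (rec_succ (rec_oracle (rec_nth _ _ 0)))))) => // k v _.
by rewrite mkseqS -cats1 str_code_cat size_mkseq.
Qed.

End TaggedRecursive.

Lemma dist_eq0 m n : ((m - n) + (n - m) == 0) = (m == n).
Proof. by rewrite addn_eq0 !subn_eq0 -eqn_leq. Qed.

Lemma take_mkseq T (x : nat -> T) m n : m <= n -> take m (mkseq x n) = mkseq x m.
Proof. by move=> mn; rewrite /mkseq -map_take take_iota (minn_idPl mn). Qed.

Local Open Scope classical_set_scope.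

(** * The set computed from the random real and its large levels *)

Definition tagged_prefixes (z : nat -> bool) : set (seq bool) :=
  [set s | tagged s = mkseq z (size s)].

Lemma turing_le_tagged_prefixes z : turing_le (tagged_prefixes z) z.
Proof.
have hc : total_recursive z 1 (nth 0 ^~ 0) by exact: rec_nth.
have hT := rec_tagged hc; have hP := rec_prefix_oracle (rec_code_size hc).
(* Truncated subtraction from 1 turns the distance of the two codes into the truth value of their
   equality. *)
have [f fF] := rec_sub (rec_cst z 1 1) (rec_dist hT hP).
exists f => s; apply/fF => /=; rewrite str_codeK.
set d := _ + _; have dE : (d == 0) = (s \in tagged_prefixes z).
  rewrite dist_eq0; apply/eqP/idP => [/str_code_inj sz|]; first by rewrite inE.
  by rewrite inE => ->.
by rewrite -dE; case: d {dE}.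
Qed.

(** At this length the overwriting block is [mkseq z k] itself, so any first [k] bits followed by
    the bits of [z] give a member. *)
Lemma card_level_tagged_prefixes z k :
  2 ^ k <= #|[pred t : (str_code (mkseq z k)).-tuple bool |
               tval t \in tagged_prefixes z]|.
Proof.
set i := str_code _.
have ki : k <= i by rewrite -{1}(size_mkseq z k) size_le_str_code.
have sz (u : k.-tuple bool) : size (u ++ drop k (mkseq z i)) == i.
  by rewrite size_cat size_drop size_tuple size_mkseq subnKC.
pose g u := Tuple (sz u).
have g_inj : injective g.
  move=> u v /(congr1 (fun t => take k (val t))) /=.
  by rewrite !take_cat !size_tuple ltnn subnn !take0 !cats0 => /val_inj.
have <- : #|[set: k.-tuple bool]%SET| = 2 ^ k by rewrite cardsT card_tuple card_bool.
rewrite -(card_imset _ g_inj); apply: subset_leq_card; apply/fintype.subsetP => t.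
move=> /imsetP[u _ ->]; rewrite !inE /tagged_prefixes /=.
rewrite /tagged (eqP (sz u)) str_codeK size_mkseq drop_size_cat ?size_tuple //.
by rewrite -[RHS](cat_take_drop k) take_mkseq.
Qed.

(** The code of a [k]-bit string is at most [2 ^ k.+1 - 2], hence at most [n]. *)
Lemma level_max_tagged_prefixes z n k : 2 ^ k.+1 <= n.+2 ->
  2 ^ k <= level_max (tagged_prefixes z) n.
Proof.
move=> kn; apply: leq_trans (card_level_tagged_prefixes z k) _.
have iP : str_code (mkseq z k) < n.+1.
  have := str_code_lt (mkseq z k); rewrite size_mkseq => /leq_trans; apply.
  by rewrite leq_subLR add1n.
exact: (leq_bigmax (Ordinal iP)).
Qed.

(** * The Martin-Loef test *)

(** Kraft's inequality scaled by [2 ^ N] to stay in the naturals. The induction splits [L] by first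
    bit; a list containing the empty string is a singleton. *)
Lemma kraft_seq N (L : seq (seq bool)) : uniq L ->
    {in L, forall p, size p <= N} ->
    {in L &, forall p q, prefix p q -> p = q} ->
  (\sum_(p <- L) 2 ^ (N - size p) <= 2 ^ N)%N.
Proof.
elim: N L => [|N IHN] L uL sL pL.
  have : {subset L <= [:: [::]]} by move=> p /sL; rewrite leqn0 inE size_eq0.
  move=> /(uniq_leq_size uL); case: L {uL sL pL} => [|p [|//]] _.
    by rewrite big_nil.
  by rewrite big_seq1 sub0n.
have [nilL|nilL] := boolP ([::] \in L).
  have : {subset L <= [:: [::]]}.
    by move=> p Lp; rewrite inE -(pL [::] p nilL Lp (prefix0s p)).
  move=> /(uniq_leq_size uL); case: L nilL {uL sL pL} => [|p [|//]] // nilL _.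
  by rewrite big_seq1 leq_exp2l // leq_subr.
pose tails b := [seq behead p | p <- L & head false p == b].
have consL b p : (p \in tails b) = (b :: p \in L).
  apply/mapP/idP => [[[|c q]]|bpL].
  - by rewrite mem_filter (negbTE nilL) andbF.
  - by rewrite mem_filter /= => /andP[/eqP-> qL ->].
  - by exists (b :: p); rewrite // mem_filter eqxx.
have tails_le b : (\sum_(p <- tails b) 2 ^ (N - size p) <= 2 ^ N)%N.
  apply: IHN => [|p|p q].
  - rewrite map_inj_in_uniq ?filter_uniq // => [] [|c p] [|d q];
      rewrite !mem_filter ?(negbTE nilL) ?andbF //=.
    by move=> /andP[/eqP-> _] /andP[/eqP-> _] ->.
  - by rewrite consL => /sL.
  - rewrite !consL => bp bq pq.
    by have := pL _ _ bp bq; rewrite prefix_cons eqxx => /(_ pq)[].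
have tailsE b : (\sum_(p <- L | head false p == b) 2 ^ (N.+1 - size p) =
    \sum_(p <- tails b) 2 ^ (N - size p))%N.
  rewrite big_map big_filter big_seq_cond [RHS]big_seq_cond.
  by apply: eq_bigr => -[|c p] //; rewrite (negbTE nilL).
rewrite (bigID (fun p => head false p == true)) /= tailsE.
rewrite [X in (_ + X)%N](eq_bigl (fun p => head false p == false)) => [|p];
  last by case: head.
by rewrite tailsE expnS mul2n -addnn leq_add.
Qed.

Section Measure.
Variable R : realType.
Local Open Scope ring_scope.

Lemma kraft (L : seq (seq bool)) : uniq L ->
    {in L &, forall p q, prefix p q -> p = q} ->
  \sum_(p <- L) 2%:R ^- size p <= 1 :> R.
Proof.
move=> uL pL; pose N := (\max_(p <- L) size p)%N.
have sL : {in L, forall p, size p <= N}%N.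
  by move=> p Lp; rewrite /N (big_rem p) //= leq_maxl.
rewrite -(ler_pM2l (_ : 0 < 2%:R ^+ N)) ?exprn_gt0 // mulr1 mulr_sumr.
have -> : \sum_(p <- L) 2%:R ^+ N * 2%:R ^- size p =
    (\sum_(p <- L) 2 ^ (N - size p))%N%:R :> R.
  rewrite natr_sum; apply: eq_big_seq => p /sL pN.
  by rewrite natrX expfB_cond ?pnatr_eq0.
by rewrite -natrX ler_nat kraft_seq.
Qed.

Variable U : seq bool -> seq bool -> Prop.
Hypothesis pfU : prefix_free_machine U.

Lemma machine_fun p s t : U p s -> U p t -> s = t.
Proof.
have [[f fU] _] := pfU => /fU fs /fU ft.
exact/str_code_inj/(rec_eval_fun fs ft).
Qed.

Definition tagged_compressible n : set (seq bool) :=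
  [set t | exists p s, [/\ U p s, (n + size p <= size s)%N & t = tagged s]].

Local Open Scope ereal_scope.

Lemma esum_tagged_compressible n :
  \esum_(t in tagged_compressible n) ((2%:R ^- size t)%:E : \bar R)
    <= (2%:R ^- n)%:E.
Proof.
(* [h] chooses one witnessing program per string, so that the weights can be compared with those of
   a prefix-free set. *)
have [h hP] : {h : seq bool -> seq bool & forall t, tagged_compressible n t ->
    exists s, [/\ U (h t) s, (n + size (h t) <= size s)%N & t = tagged s]}.
  apply: (@boolp.choice _ _ (fun t p => tagged_compressible n t ->
    exists s, [/\ U p s, (n + size p <= size s)%N & t = tagged s])) => t.
  by have [[p tp]|nt] := pselect (tagged_compressible n t); [exists p|exists [::]].
(* The sum is a supremum over finite subsets, so Kraft's inequality for finite lists is enough. *)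
apply: ge_ereal_sup => _ [A [finA subA] <-].
rewrite fsbig_finite //= sumEFin lee_fin.
set L := fset_set A.
have LA t : t \in L -> tagged_compressible n t.
  by rewrite /L in_fset_set // inE => /subA.
(* A program determines its output [s], and [s] determines [tagged s]. *)
have h_inj : {in L &, injective h}.
  move=> t t' /LA/hP[s [Us _ ts]] /LA/hP[s' [Us' _ ts']] ehh.
  by rewrite ehh in Us; rewrite ts ts' (machine_fun Us Us').
apply: (@le_trans _ _ (\sum_(t <- L) (2%:R ^- n * 2%:R ^- size (h t)))%R).
  rewrite !big_seq; apply: ler_sum => t /LA/hP[s [_ ns {1}->]].
  rewrite size_tagged -invfM -exprD lef_pV2 ?posrE ?exprn_gt0 //.
  by rewrite ler_weXn2l // ler1n.
rewrite -mulr_sumr -(big_map h xpredT (fun p => 2%:R ^- size p)%R).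
rewrite ler_piMr ?invr_ge0 ?exprn_ge0 //; apply: kraft.
  by rewrite map_inj_in_uniq ?fset_uniq.
move=> _ _ /mapP[t /LA/hP[s [Us _ _]] ->] /mapP[t' /LA/hP[s' [Us' _ _]] ->].
exact: (proj2 pfU) Us Us'.
Qed.

End Measure.

Section Test.
Variables (R : realType) (U : seq bool -> seq bool -> Prop).
Hypothesis pfU : prefix_free_machine U.

(* The program is [size s] with its leading bits ignored, so that every program
   occurs for arbitrarily long [s]; semideciding membership then requires a
   single run of [U] instead of a dovetailed search. *)
Definition program_at (s : seq bool) :=
  str_of ((size s).+1 - 2 ^ size (str_of (size s))).

(** Taking extensions of [tagged t] leaves the length of [s] free to encode the program; the open
    set is that of [tagged_compressible]. *)
Definition tagged_test n : set (seq bool) :=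
  [set s | exists t, [/\ U (program_at s) t,
    n + size (program_at s) <= size t & prefix (tagged t) s]].

Lemma uniformly_ce_tagged_test : uniformly_ce tagged_test.
Proof.
have [[fU hU] _] := pfU.
pose pos n i := rec_nth no_oracle n i.
pose prog n i := rec_sub (rec_succ (rec_code_size (pos n i)))
  (rec_exp2 (rec_code_size (rec_code_size (pos n i)))).
have hd := rec_code_size (pos 3 0).
(* The test sees the output of [U], [n] and the code of [s] in positions 0, 1, 2. Its two summands
   vanish when the length condition and the prefix condition hold. *)
have [f fP] := rec_domain fU (rec_add
  (rec_sub (rec_add (pos 3 1) (rec_code_size (prog 3 2))) hd)
  (rec_dist (pos 3 2) (rec_add (rec_tagged (pos 3 0))
    (rec_mul (rec_exp2 hd) (rec_iter_code_tail hd (pos 3 2))))))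
  (prog 2 1).
exists f => n s; rewrite fP /= !str_codeK -/(program_at s).
have prefE t : (str_code s == str_code (tagged t) + 2 ^ size t *
    iter (size t) (fun m => m.-1./2) (str_code s)) = prefix (tagged t) s.
  rewrite str_code_tail -(size_tagged t) -str_code_cat (inj_eq str_code_inj).
  apply/eqP/idP => [->|/prefixP[r ->]]; first exact: prefix_prefix.
  by rewrite drop_size_cat.
have -> : (size s).+1 - 2 ^ size (str_of (size s)) = str_code (program_at s).
  by rewrite str_ofK.
split=> [[t [Ut nt pt]]|[d Ud /eqP]].
  exists (str_code t); first exact/hU.
  by apply/eqP; rewrite str_codeK addn_eq0 dist_eq0 prefE pt andbT subn_eq0.
rewrite addn_eq0 dist_eq0 prefE subn_eq0 => /andP[nt pt].
by exists (str_of d); split=> //; apply/hU; rewrite str_ofK.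
Qed.

Lemma cylinders_tagged_test n :
  cylinders (tagged_test n) = cylinders (tagged_compressible U n).
Proof.
apply/seteqP; split=> x [s].
  move=> [t [Ut nt /prefixP[r sE]]] xs.
  exists (tagged t); first by exists (program_at s), t.
  have ts : size (tagged t) <= size s by rewrite sE (size_cat (tagged t)) leq_addr.
  by rewrite -(take_mkseq _ ts) xs sE take_size_cat.
move=> [p [t [Ut nt ->]]]; rewrite size_tagged => xt.
(* Deleting the leading bit of [m.+1 = 2 ^ k + str_code p] leaves the code of [p], since [k] makes
   [2 ^ k] exceed it; [k] also makes [m] at least [size t]. *)
pose k := size t + str_code p; pose m := 2 ^ k - 1 + str_code p.
have mS : m.+1 = 2 ^ k + str_code p.
  by rewrite /m -addSn -addn1 subnK // expn_gt0.
have tm : size t <= m.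
  rewrite -ltnS mS; apply: leq_trans (leq_addr _ _).
  by apply: leq_ltn_trans (ltn_expl k _); rewrite ?leq_addr.
have pE : program_at (mkseq x m) = p.
  rewrite /program_at size_mkseq (@size_str_of k) ?mS ?addKn ?str_codeK //.
  rewrite leq_addr expnS mul2n -addnn ltn_add2l.
  by apply: leq_ltn_trans (ltn_expl k _); rewrite ?leq_addl.
exists (mkseq x m); last by rewrite size_mkseq.
by exists t; rewrite pE prefixE size_tagged take_mkseq ?xt ?eqxx.
Qed.

Lemma martin_lof_test_tagged : martin_lof_test R tagged_test.
Proof.
split=> [|n]; first exact: uniformly_ce_tagged_test.
rewrite cylinders_tagged_test.
apply: le_trans (esum_tagged_compressible R pfU n).
by apply: ereal_inf_lbound; exists (tagged_compressible U n).
Qed.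

Lemma incompressible_tagged_prefixes z : martin_lof_random R z ->
  incompressible_strings R U (tagged_prefixes z).
Proof.
move=> /(_ _ martin_lof_test_tagged) /boolp.existsNP[n /boolp.not_implyP[_]].
rewrite cylinders_tagged_test => zn.
apply: (@le_lt_trans _ _ (n%:R%:E)%E); last exact: ltry.
apply: ge_ereal_sup => _ [s sz <-].
(* A shorter description of [s] would put [tagged s], a prefix of [z], into the level [n] that [z]
   avoids. *)
have Ks : ((size s)%:R%:E - n%:R%:E <= K R U s)%E.
  apply: le_ereal_inf_tmp => _ [p Up <-].
  rewrite -EFinB lee_fin lerBlDl -natrD ler_nat leqNgt; apply/negP => ps.
  apply: zn; exists (tagged s); last by rewrite size_tagged sz.
  by exists p, s; split=> //; exact: ltnW.
(* If [K] is [+oo] the deficiency is [-oo]; the value [-oo] of [K] contradicts [Ks]. *)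
rewrite /deficiency; move: Ks; case: (K R U s) => [r| |] //=.
  by rewrite -!EFinB !lee_fin lerBlDr addrC -lerBlDr.
by rewrite addeNy leNye.
Qed.

End Test.

(** * The fatness bound *)

Local Open Scope ring_scope.

(** Here [n] is below [4 * 2 ^ k], and for [n >= 4] the squared logarithm is at least 4. For [n]
    equal to 2 or 3, [2 <= 2 ^ k] suffices. *)
Lemma div_log2_sqr_le (R : realType) n k :
    (2 <= n)%N -> (0 < k)%N -> (n.+2 < 2 ^ k.+2)%N ->
  n%:R / log2 n%:R ^+ 2 <= 2%:R ^+ k :> R.
Proof.
move=> n2 k0 nk.
have ln2 : 0 < ln (2%:R : R) by rewrite ln_gt0 // ltr1n.
have log2X m : log2 (2%:R ^+ m) = m%:R :> R.
  by rewrite /log2 lnXn ?ltr0n // -(mulr_natl (ln _)) mulfK ?gt_eqF.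
have log2_ge m j : (2 ^ j <= m)%N -> j%:R <= log2 m%:R :> R.
  move=> jm; rewrite -log2X /log2 ler_pM2r ?invr_gt0 // ler_ln ?posrE.
  - by rewrite -natrX ler_nat.
  - by rewrite exprn_gt0.
  - by rewrite ltr0n (leq_trans _ jm) // expn_gt0.
have log_gt0 : 0 < log2 n%:R :> R by apply: lt_le_trans (log2_ge n 1%N n2).
rewrite ler_pdivrMr ?exprn_gt0 //.
have [n4|] := leqP 4 n.
  apply: (@le_trans _ _ (2%:R ^+ k * 2%:R ^+ 2)).
    rewrite -exprD -natrX ler_nat addn2; apply: ltnW; apply: leq_trans nk.
    by rewrite ltnS leqW.
  by rewrite ler_pM2l ?exprn_gt0 // lerXn2r ?nnegrE ?ler0n ?(ltW log_gt0) // log2_ge.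
have k1 : 2%:R <= 2%:R ^+ k :> R by rewrite -natrX ler_nat -{1}(expn1 2) leq_exp2l.
rewrite ltnS => n3; apply: le_trans (_ : 2%:R * log2 n%:R ^+ 2 <= _); last first.
  by rewrite ler_pM2r ?exprn_gt0.
move: n2 n3 log2_ge; case: n {nk log_gt0} => [|[|[|[|n]]]] // _ _ log2_ge.
  by rewrite (log2X 1%N : log2 2%:R = 1) expr1n mulr1.
(* From [2 ^ 3 <= 3 ^ 2]; then twice the squared logarithm of 3 is at least 9/2. *)
have l3 : 3%:R <= 2%:R * log2 3%:R :> R.
  apply: le_trans (log2_ge 9%N 3%N isT) _.
  rewrite /log2 mulrA ler_pM2r ?invr_gt0 //.
  have -> : 9%:R = 3%:R ^+ 2 :> R by rewrite -natrX.
  by rewrite lnXn ?ltr0n // (mulr_natl (ln _)).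
nra.
Qed.

Theorem theorem1p1 (R : realType) (U : seq bool -> seq bool -> Prop)
    (hU : universal_prefix_free_machine U)
    (z : nat -> bool) (hz : martin_lof_random R z) :
  exists D : set (seq bool),
    [/\ turing_le D z,
        incompressible_strings R U D
      & forall n : nat, (2 <= n)%N ->
          n%:R / log2 n%:R ^+ 2 <= (level_max D n)%:R :> R].
Proof.
exists (tagged_prefixes z); split.
- exact: turing_le_tagged_prefixes.
- exact: (incompressible_tagged_prefixes (proj1 hU) hz).
(* The largest [k] with [2 ^ k.+1 <= n.+2], as [level_max_tagged_prefixes] demands; it is positive
   because [n.+2 >= 4]. *)
move=> n n2; pose k := (trunc_log 2 n.+2).-1.
have kS : k.+1 = trunc_log 2 n.+2.
  by rewrite prednK // trunc_log_gt0 //= ; apply: leq_trans n2 _.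
have /andP[kn nk] := trunc_log_bounds (isT : 1 < 2)%N (isT : 0 < n.+2)%N.
rewrite -kS in kn nk.
have k0 : (0 < k)%N.
  by rewrite -ltnS kS trunc_log_max.
apply: le_trans (div_log2_sqr_le R n2 k0 nk) _.
by rewrite -natrX ler_nat level_max_tagged_prefixes.
Qed.
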